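(* For $p\in(0,1)$, let $\mu_p$ be the self-similar measure on the middle third Cantor set corresponding to Bernoulli weights $p,(1-p)$. Then \[ \dim_{\mathrm F}\mu_p=\dim_{\mathrm F}^{0}\mu_p=0, \] \[ \dim_{\mathrm F}^{1/2}\mu_p=\frac{\log\left(p^4+4p^2(1-p)^2+(1-p)^4\right)}{-2\log3} \] and \[ \dim_{\mathrm S}\mu_p=\dim_{\mathrm F}^{1}\mu_p=\frac{\log\left(p^2+(1-p)^2\right)}{-\log3}<2\dim_{\mathrm F}^{1/2}\mu_p . \] In particular, $\theta\mapsto\dim_{\mathrm F}^{\theta}\mu_p$ is not a linear function on $[0,1]$.
   Context: $\mu_p$ is the unique Borel probability measure on $\mathbb{R}$ with $\mu_p=p\,\mu_p\circ S_0^{-1}+(1-p)\,\mu_p\circ S_1^{-1}$, where $S_0(x)=x/3$ and $S_1(x)=x/3+2/3$. For a finite Borel measure $\mu$ on $\mathbb{R}$ write $\widehat\mu(z)=\int e^{-2\pi i zx}\,d\mu(x)$. For $s\geq 0$ and $\theta\in(0,1]$ let $\mathcal{J}_{s,\theta}(\mu)=\left(\int_{\mathbb{R}}|\widehat\mu(z)|^{2/\theta}|z|^{s/\theta-1}\,dz\right)^{\theta}$, and let $\mathcal{J}_{s,0}(\mu)=\sup_{z\in\mathbb{R}}|\widehat\mu(z)|^2|z|^s$. The Fourier spectrum of $\mu$ at $\theta\in[0,1]$ is $\dim_{\mathrm F}^{\theta}\mu=\sup\{s\geq 0:\mathcal{J}_{s,\theta}(\mu)<\infty\}$, with $\sup\emptyset=0$;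 $\dim_{\mathrm F}\mu=\dim_{\mathrm F}^0\mu$ is the Fourier dimension and $\dim_{\mathrm S}\mu=\dim_{\mathrm F}^1\mu$ is the Sobolev dimension. *)

(* Defs.v *)
From HB Require Import structures.
From mathcomp Require Import all_boot all_order all_algebra.
From mathcomp Require Import complex.
From mathcomp Require Import all_classical all_reals all_analysis.

Set Implicit Arguments.
Unset Strict Implicit.
Unset Printing Implicit Defensive.

Import Order.TTheory GRing.Theory Num.Theory.
Import numFieldNormedType.Exports.

Local Open Scope classical_set_scope.
Local Open Scope ring_scope.

(* [measurableTypeR R] is R with its Borel sigma-algebra. *)

(* e^{-2 pi i z x} = cos (2 pi z x) - i sin (2 pi z x), integrated
   componentwise: the library integrates only real-valued functions. *)
Definition fourier_transform (R : realType)
    (mu : {finite_measure set (measurableTypeR R) -> \bar R}) (z : R) : R[i] :=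
  Complex (\int[mu]_x cos (2 * pi * z * x))
          (- \int[mu]_x sin (2 * pi * z * x)).

Definition fourier_norm (R : realType)
    (mu : {finite_measure set (measurableTypeR R) -> \bar R}) (z : R) : R :=
  ComplexField.Normc.normc (fourier_transform mu z).

(* [powR] satisfies 0 `^ 0 = 1 and 0 `^ a = 0 for a != 0, so the integrand takes
   the value 0 instead of +oo at z = 0 when s < theta, on a null set only. *)
Definition fourier_energy (R : realType)
    (mu : {finite_measure set (measurableTypeR R) -> \bar R})
    (s theta : R) : \bar R :=
  if theta == 0 then
    ereal_sup (range (fun z : R => (fourier_norm mu z ^+ 2 * `|z| `^ s)%:E))
  else
    poweR (\int[lebesgue_measure]_z
             (fourier_norm mu z `^ (2 / theta) *
              `|z| `^ (s / theta - 1))%:E)%E theta.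

(* Adjoining 0 realises sup set0 = 0 ([ereal_sup set0] is -oo) and does not
   change the supremum of a nonempty set of nonnegative numbers. *)
Definition fourier_spectrum (R : realType)
    (mu : {finite_measure set (measurableTypeR R) -> \bar R})
    (theta : R) : \bar R :=
  ereal_sup ([set 0%:E] `|`
    EFin @` [set s : R | 0 <= s /\ (fourier_energy mu s theta < +oo)%E]).

Definition fourier_dim (R : realType)
    (mu : {finite_measure set (measurableTypeR R) -> \bar R}) : \bar R :=
  fourier_spectrum mu 0.

Definition sobolev_dim (R : realType)
    (mu : {finite_measure set (measurableTypeR R) -> \bar R}) : \bar R :=
  fourier_spectrum mu 1.

Definition cantor_S0 (R : realType) (x : measurableTypeR R) :
  measurableTypeR R := (x : R) / 3.

Definition cantor_S1 (R : realType) (x : measurableTypeR R) :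
  measurableTypeR R := (x : R) / 3 + 2 / 3.

(* The invariance equation that characterises mu_p uniquely among Borel
   probability measures. *)
Definition is_cantor_measure (R : realType) (p : R)
    (mu : probability (measurableTypeR R) R) : Prop :=
  forall A : set (measurableTypeR R), measurable A ->
    mu A = (p%:E * pushforward mu (@cantor_S0 R) A +
            (1 - p)%:E * pushforward mu (@cantor_S1 R) A)%E.

(* Main.v *)
(* With q = 1 - p, self-similarity gives |mu^(3z)|^2 = g(z) |mu^(z)|^2 with
   g(z) = p^2 + q^2 + 2pq cos(4 pi z).  Hence mu^ does not decay along powers
   of 3, and the Fourier dimension is 0.  For r = 1, 2 the frequencies of g^r
   (in units of 4 pi) lie in {-2..2}, and a nontrivial sum of 3^j k_j with
   |k_j| <= 2 never vanishes; so the product over j < n of g(3^j z)^r has mean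
   exactly lambda^n, lambda being the mean of g^r.  Therefore the integral of
   |mu^|^(2r) over the shell [3^n, 3^(n+1)] is comparable to (3 lambda)^n and
   the energy at theta = 1/r is a geometric series of ratio 3^(rs) lambda, which
   gives the thresholds for r = 1 (Sobolev) and r = 2. *)
Require Import Defs.
From HB Require Import structures.
From mathcomp Require Import all_boot all_order all_algebra.
From mathcomp Require Import ring lra.
From mathcomp Require Import all_classical all_reals all_analysis.
From mathcomp Require Import measurable_realfun.

Import Order.TTheory GRing.Theory Num.Theory.
Import numFieldNormedType.Exports.

Local Open Scope classical_set_scope.
Local Open Scope ring_scope.

(** * Cosine polynomials of period 1/2, with their constant term *)

Section cos_poly.
Context {R : realType}.
Implicit Types (f : R -> R) (a b c m x : R) (k : nat).

(* The first index is the constant term; writing the other frequencies as k.+1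
   keeps them nonzero. *)
Inductive cos_poly : R -> (R -> R) -> Prop :=
| cos_poly_cst c : cos_poly c (fun=> c)
| cos_poly_cos c k : cos_poly 0 (fun x => c * cos (4 * pi * k.+1%:R * x))
| cos_polyD m1 m2 f1 f2 : cos_poly m1 f1 -> cos_poly m2 f2 ->
    cos_poly (m1 + m2) (fun x => f1 x + f2 x).

(* Resonance-free step: 3 (k + 1) +- 1 and 3 (k + 1) +- 2 are still nonzero, so
   the constant terms multiply. *)
Lemma cos_poly_triple m f lam a b : cos_poly m f ->
  cos_poly (lam * m)
    (fun x => (lam + a * cos (4 * pi * x) + b * cos (4 * pi * 2 * x)) * f (3 * x)).
Proof.
elim=> [c|c k|m1 m2 f1 f2 _ IH1 _ IH2].
- have := cos_polyD _ _ _ _ (cos_polyD _ _ _ _ (cos_poly_cst (lam * c))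
    (cos_poly_cos (a * c) 0)) (cos_poly_cos (b * c) 1).
  rewrite !addr0; congr (cos_poly _ _); apply/funext => x; rewrite mulr1.
  by ring.
- have := cos_polyD _ _ _ _ (cos_poly_cos (lam * c) (3 * k + 2))
   (cos_polyD _ _ _ _
     (cos_polyD _ _ _ _ (cos_poly_cos (a * c / 2) (3 * k + 3))
       (cos_poly_cos (a * c / 2) (3 * k + 1)))
     (cos_polyD _ _ _ _ (cos_poly_cos (b * c / 2) (3 * k + 4))
       (cos_poly_cos (b * c / 2) (3 * k)))).
  rewrite !addr0 mulr0; congr (cos_poly _ _); apply/funext => x.
  set u := 4 * pi * k.+1%:R * (3 * x).
  have E j : 4 * pi * (3 * k + j).+1%:R * x = u + 4 * pi * (j%:R - 2) * x.
    by rewrite /u -(natr1 k) -(natr1 (3 * k + j)) natrD natrM; ring.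
  have := (E 0%N, E 1%N, E 2%N, E 3%N, E 4%N); rewrite addn0 => {}E.
  rewrite !E.
  rewrite (_ : 4 * pi * (0 - 2) * x = - (4 * pi * 2 * x)); last by ring.
  rewrite (_ : 4 * pi * (1 - 2) * x = - (4 * pi * x)); last by ring.
  rewrite (_ : 4 * pi * (2 - 2) * x = 0); last by ring.
  rewrite (_ : 4 * pi * (3 - 2) * x = 4 * pi * x); last by ring.
  rewrite (_ : 4 * pi * (4 - 2) * x = 4 * pi * 2 * x); last by ring.
  rewrite addr0.
  by rewrite !cosB !cosD; field.
- rewrite mulrDr.
  have := cos_polyD _ _ _ _ IH1 IH2.
  by congr (cos_poly _ _); apply/funext => x; ring.
Qed.

(** Every frequency is a nonzero multiple of [4 * pi] or the constant one, so the primitive of each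
    cosine has period 1/2 and only the constant term contributes to the increment. *)
Lemma cos_poly_primitive m f : cos_poly m f ->
  exists G : R -> R, (forall x, is_derive x (1 : R) G (f x)) /\
    forall x, G (x + 2^-1) = G x + m / 2.
Proof.
elim=> [c|c k|m1 m2 f1 f2 _ [G1 [d1 p1]] _ [G2 [d2 p2]]].
- exists (fun x => c * x); split=> [x|x]; last by rewrite mulrDr.
  apply: trigger_derive.
  by rewrite /GRing.scale /=; ring.
- pose w : R := 4 * pi * k.+1%:R.
  have w0 : w != 0 by rewrite /w !mulf_neq0// ?pnatr_eq0// gt_eqF// pi_gt0.
  exists (fun x => c / w * sin (w * x)); split=> [x|x]; last first.
    rewrite mul0r addr0; congr (_ * _); rewrite mulrDr.
    (* A shift of [x] by 1/2 moves the argument through [k.+1] full turns. *)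
    have -> : w / 2 = pi *+ 2 *+ k.+1.
      by rewrite /w -[RHS]mulr_natr -[pi *+ 2]mulr_natr; field.
    exact: (periodicn (@sinD2pi R)).
  apply: trigger_derive.
  by rewrite /GRing.scale /=; field.
- exists (fun x => G1 x + G2 x); split=> [x|x].
    exact: is_deriveD.
  by rewrite p1 p2; field.
Qed.

End cos_poly.

(** * Exact integrals of dilated cosine polynomials *)

Section cos_poly_integral.
Context {R : realType}.
Implicit Types (f : R -> R).
Lemma continuous_cos_poly m f : cos_poly m f -> continuous f.
Proof.
elim=> [c|c k|m1 m2 f1 f2 _ c1 _ c2] x.
- exact: cst_continuous.
- apply: continuousM; first exact: cst_continuous.
  apply: continuous_comp; last exact: continuous_cos.
  by apply: continuousM; [exact: cst_continuous|move=> ?; exact: cvg_id].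
- by apply: continuousD; [exact: c1|exact: c2].
Qed.

Lemma continuous_cos_poly_scale m f (t : R) :
  cos_poly m f -> continuous (fun z : R => f (z / t)).
Proof.
move=> fm z; apply: continuous_comp; last exact: (continuous_cos_poly _ _ fm).
by apply: continuousM; [move=> ?; exact: cvg_id|exact: cst_continuous].
Qed.

(** The interval consists of [n] whole periods of length [t / 2], so the oscillating terms cancel
    exactly, wherever it starts, and no error term disturbs the mean. *)
Lemma cos_poly_integral m f (t a : R) n : cos_poly m f -> 0 < t -> (0 < n)%N ->
  (\int[lebesgue_measure]_(z in `[(t * a)%R, (t * (a + n%:R / 2))%R])
     (f (z / t))%:E = (t * (n%:R / 2) * m)%:E)%E.
Proof.
move=> fm t0 n0; have [G [dG pG]] := cos_poly_primitive _ _ fm.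
have pGn j : G (a + j%:R / 2) = G a + j%:R / 2 * m.
  elim: j => [|j IH]; first by rewrite !mul0r !addr0.
  rewrite -natr1 [in LHS]mulrDl mul1r addrA pG IH; ring.
have dH (z : R) : is_derive z (1 : R) (fun z => t * G (z / t)) (f (z / t)).
  have dt : is_derive z (1 : R) (fun z => z / t) t^-1.
    by apply: trigger_derive; rewrite /GRing.scale/= !mulr0 add0r mulr1.
  have dGz := dG (z / t).
  have dc : is_derive z (1 : R) (fun z => G (z / t)) (f (z / t) * t^-1).
    exact: (@is_derive1_comp _ G (fun z => z / t)).
  by apply: trigger_derive; rewrite /GRing.scale/=; field; rewrite gt_eqF.
rewrite (@continuous_FTC2 _ (fun z => f (z / t)) (fun z => t * G (z / t))).
- rewrite -EFinB; congr EFin.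
  have tE (u : R) : t * u / t = u by field; rewrite gt_eqF.
  rewrite !tE pGn; ring.
- by rewrite ltr_pM2l// ltrDl divr_gt0// ltr0n.
- by apply: continuous_subspaceT; exact: continuous_cos_poly_scale fm.
- have cH : continuous (fun z : R => t * G (z / t)).
    move=> z; apply: differentiable_continuous; apply/derivable1_diffP.
    exact: (@ex_derive _ _ _ _ _ _ _ (dH z)).
  split=> [z _||].
  + exact: (@ex_derive _ _ _ _ _ _ _ (dH z)).
  + by apply: cvg_at_right_filter; exact: cH.
  + by apply: cvg_at_left_filter; exact: cH.
- move=> z _; rewrite derive1E.
  exact: (@derive_val _ _ _ _ _ _ _ (dH z)).
Qed.
End cos_poly_integral.

(** * Self-similarity of integrals against the Cantor measure *)

Section self_similar_integral.
Context {R : realType} {p : R} (hp0 : 0 < p) (hp1 : p < 1)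
    {mu : probability (measurableTypeR R) R} (hmu : is_cantor_measure p mu).

(** By invariance [mu] agrees on measurable sets with a sum of two scaled pushforwards; a change of
    variables in each gives the formula. *)
Lemma ge0_cantor_integral (f : R -> R) :
  measurable_fun [set: measurableTypeR R] f -> (forall x, 0 <= f x) ->
  (\int[mu]_x (f x)%:E = p%:E * \int[mu]_x (f (x / 3))%:E
    + (1 - p)%:E * \int[mu]_x (f (x / 3 + 2 / 3))%:E)%E.
Proof.
move=> mf f0.
have mS0 : measurable_fun [set: measurableTypeR R] (@cantor_S0 R).
  by apply: measurable_funM.
have mS1 : measurable_fun [set: measurableTypeR R] (@cantor_S1 R).
  by apply: measurable_funD => //; apply: measurable_funM.
pose p0 := NngNum (ltW hp0).
have q0' : 0 <= 1 - p by rewrite subr_ge0 ltW.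
pose q0 := NngNum q0'.

rewrite (eq_measure_integral (measure_add
    (mscale p0 (pushforward mu (@cantor_S0 R)))
    (mscale q0 (pushforward mu (@cantor_S1 R))))); last first.
  move=> A mA _; apply: etrans (hmu A mA) _.
  by rewrite /= /msum 2!big_ord_recl big_ord0 adde0.
have mf' : measurable_fun [set: measurableTypeR R] (fun x => (f x)%:E).
  exact/measurable_EFinP.
have f0' (x : R) : (0 <= (f x)%:E)%E by rewrite lee_fin.
rewrite ge0_integral_measure_add//.
by rewrite !ge0_integral_mscale// !ge0_integral_pushforward.
Qed.

Lemma integrable_norm_le1 (f : R -> R) :
  measurable_fun [set: measurableTypeR R] f -> (forall x, `|f x| <= 1) ->
  mu.-integrable setT (EFin \o f).
Proof.
move=> mf f1; apply: measurable_bounded_integrable => //.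
  by rewrite -ge0_fin_numE //; exact: fin_num_measure.
by exists 1; split => // M M1 x _; exact: le_trans (f1 x) (ltW M1).
Qed.

Lemma cantor_Rintegral (f : R -> R) :
  measurable_fun [set: measurableTypeR R] f -> (forall x, `|f x| <= 1) ->
  \int[mu]_x f x = p * \int[mu]_x f (x / 3)
    + (1 - p) * \int[mu]_x f (x / 3 + 2 / 3).
Proof.
move=> mf f1.
have shift (g : R -> R) : measurable_fun [set: measurableTypeR R] g ->
    (forall x, `|g x| <= 1) ->
    (\int[mu]_x (1 + g x)%:E = (1 + \int[mu]_x g x)%:E)%E.
  move=> mg g1; have ig := integrable_norm_le1 g mg g1.
  under eq_integral do rewrite EFinD.
  rewrite integralD//; last by apply: integrable_norm_le1 => // x; rewrite normr1.
  have -> : (\int[mu]_x 1 = 1)%E.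
    rewrite integral_cst// mul1e; exact: (probability_setT mu).
  rewrite EFinD; congr (_ + _)%E.
  by rewrite fineK// integrable_fin_num.
have mS0 : measurable_fun [set: measurableTypeR R] (fun x => f (x / 3)).
  by apply: measurableT_comp => //; exact: measurable_funM.
have mS1 : measurable_fun [set: measurableTypeR R] (fun x => f (x / 3 + 2 / 3)).
  by apply: measurableT_comp => //; apply: measurable_funD => //; exact: measurable_funM.
(* The bound on [f] makes [1 + f] nonnegative. The added constant contributes 1 to both sides, since
   the weights sum to 1, and then cancels. *)
have := ge0_cantor_integral (fun x => 1 + f x).
rewrite !shift// -!EFinM -EFinD => H; apply: (addrI 1).
have {}H : forall x, 0 <= 1 + f x -> 1 + \int[mu]_x f x = p * (1 + \int[mu]_x f (x / 3))
    + (1 - p) * (1 + \int[mu]_x f (x / 3 + 2 / 3)).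
  move=> _ _; apply/EFin_inj/H; first exact: measurable_funD.
  by move=> x; have := f1 x; rewrite ler_norml => /andP[]; lra.
rewrite (H 0); first by ring.
by have := f1 0; rewrite ler_norml => /andP[]; lra.
Qed.

End self_similar_integral.

(** * The Fourier transform: continuity, bounds and refinement under tripling *)

Section fourier.
Context {R : realType} {mu : probability (measurableTypeR R) R}.

Lemma measurable_cosM (z : R) :
  measurable_fun [set: measurableTypeR R] (fun x => cos (2 * pi * z * x)).
Proof.
apply: measurableT_comp; last exact: measurable_funM.
by apply: continuous_measurable_fun; exact: continuous_cos.
Qed.

Lemma measurable_sinM (z : R) :
  measurable_fun [set: measurableTypeR R] (fun x => sin (2 * pi * z * x)).
Proof.
apply: measurableT_comp; last exact: measurable_funM.
by apply: continuous_measurable_fun; exact: continuous_sin.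
Qed.

Lemma fourier_norm_sqr (z : R) : fourier_norm mu z ^+ 2 =
  (\int[mu]_x cos (2 * pi * z * x)) ^+ 2 + (\int[mu]_x sin (2 * pi * z * x)) ^+ 2.
Proof.
by rewrite /fourier_norm /fourier_transform /= sqrrN sqr_sqrtr// addr_ge0// sqr_ge0.
Qed.

Lemma fourier_norm_ge0 (z : R) : 0 <= fourier_norm mu z.
Proof. exact: sqrtr_ge0. Qed.

Lemma fourier_normN (z : R) : fourier_norm mu (- z) = fourier_norm mu z.
Proof.
apply/eqP; rewrite -(@eqrXn2 _ 2)// ?fourier_norm_ge0// !fourier_norm_sqr.
under eq_Rintegral do rewrite mulrN mulNr cosN.
apply/eqP; congr (_ + _).
under eq_Rintegral do rewrite mulrN mulNr sinN -mulN1r.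
rewrite RintegralZl ?mulN1r ?sqrrN//.
apply: integrable_norm_le1 => [|x]; [exact: measurable_sinM|exact: sin_max].
Qed.

(** Dominated convergence near [z], with the constant 1 as integrable majorant. *)
Lemma continuous_bounded_Rintegral (h : R -> R) : continuous h ->
  (forall x, `|h x| <= 1) ->
  continuous (fun z : R => \int[mu]_x h (2 * pi * z * x)).
Proof.
move=> ch h1 z.
have := @continuity_under_integral R _ _ mu (fun z x => h (2 * pi * z * x)) setT
  measurableT (z - 1) (z + 1) _ _ (cst 1) _ _ z.
apply => //.
- move=> y _; apply: integrable_norm_le1 => //.
  apply: measurableT_comp; last exact: measurable_funM.
  exact: continuous_measurable_fun.
- apply: aeW => x _ y _.
  apply: (@continuous_comp _ _ _ (fun y : R => 2 * pi * y * x)); last exact: ch.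
  apply: continuousM; last exact: cst_continuous.
  by apply: continuousM; [exact: cst_continuous|exact: cvg_id].
- by apply: integrable_norm_le1 => // x; rewrite normr1.
- by move=> y _; apply: aeW.
- by rewrite inE /= in_itv/=; apply/andP; split; lra.
Qed.

Lemma continuous_fourier_norm : continuous (fourier_norm mu).
Proof.
have -> : fourier_norm mu = (fun z : R => Num.sqrt
    ((\int[mu]_x cos (2 * pi * z * x)) ^+ 2 +
     (\int[mu]_x sin (2 * pi * z * x)) ^+ 2)).
  apply/funext => y.
  by rewrite -fourier_norm_sqr sqrtr_sqr ger0_norm// fourier_norm_ge0.
move=> z; apply: continuous_comp; last exact: sqrt_continuous.
apply: continuousD.
  apply: (@continuous_comp _ _ _ _ (fun x : R => x ^+ 2)); last exact: exprn_continuous.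
  apply: continuous_bounded_Rintegral; [exact: continuous_cos|exact: cos_max].
apply: (@continuous_comp _ _ _ _ (fun x : R => x ^+ 2)); last exact: exprn_continuous.
apply: continuous_bounded_Rintegral; [exact: continuous_sin|exact: sin_max].
Qed.

Lemma Rintegral1 : \int[mu]_x (1 : R) = 1.
Proof.
by rewrite Rintegral_cst// mul1r -[RHS]/(fine 1); congr fine; exact: (probability_setT mu).
Qed.

Lemma Rintegral_norm_le1 (h : R -> R) :
  measurable_fun [set: measurableTypeR R] h -> (forall x, `|h x| <= 1) ->
  `|\int[mu]_x h x| <= 1.
Proof.
move=> mh h1.
have ih : mu.-integrable setT (EFin \o h) by exact: integrable_norm_le1.
apply: (le_trans (le_normr_Rintegral measurableT ih)).
rewrite -[leRHS]Rintegral1.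
apply: le_Rintegral => //.
  apply: integrable_norm_le1 => [|x]; last by rewrite normr_id.
  exact: measurableT_comp.
by apply: integrable_norm_le1 => // x; rewrite normr1.
Qed.

(** Cosine and sine integrals are bounded separately, which is crude; a constant factor does not
    affect the finiteness of the energies. *)
Lemma fourier_norm_le2 (z : R) : fourier_norm mu z <= 2.
Proof.
rewrite -ler_sqr ?nnegrE ?fourier_norm_ge0//.
have sqr1 (u : R) : `|u| <= 1 -> u ^+ 2 <= 1.
  by move=> u1; rewrite -real_normK ?num_real// exprn_ile1.
have /sqr1 : `|\int[mu]_x cos (2 * pi * z * x)| <= 1.
  by apply: Rintegral_norm_le1 => [|x]; [exact: measurable_cosM|exact: cos_max].
have /sqr1 : `|\int[mu]_x sin (2 * pi * z * x)| <= 1.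
  by apply: Rintegral_norm_le1 => [|x]; [exact: measurable_sinM|exact: sin_max].
rewrite fourier_norm_sqr; lra.
Qed.

Lemma fourier_norm0 : fourier_norm mu 0 = 1.
Proof.
apply/eqP; rewrite -(@eqrXn2 _ 2)// ?fourier_norm_ge0// fourier_norm_sqr.
under eq_Rintegral do rewrite mulr0 mul0r cos0.
rewrite [X in _ + X ^+ 2](_ : _ = 0); last first.
  by under eq_Rintegral do rewrite mulr0 mul0r sin0; rewrite Rintegral_cst// mul0r.
by rewrite Rintegral1 expr1n expr0n addr0.
Qed.

Section cantor.
Context {p : R} (hp0 : 0 < p) (hp1 : p < 1) (hmu : is_cantor_measure p mu).

(** Both maps contract by 3, which turns [3 * z] back into [z], and the second adds the phase
    [4 * pi * z]. The factor is the squared modulus of $p+(1-p)e^{-4\pi iz}$. *)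
Lemma fourier_norm_refine (z : R) : fourier_norm mu (3 * z) ^+ 2 =
  (p ^+ 2 + (1 - p) ^+ 2 + 2 * p * (1 - p) * cos (4 * pi * z)) * fourier_norm mu z ^+ 2.
Proof.
pose C := \int[mu]_x cos (2 * pi * z * x).
pose S := \int[mu]_x sin (2 * pi * z * x).
have iC : mu.-integrable setT (EFin \o (fun x => cos (2 * pi * z * x))).
  by apply: integrable_norm_le1 => [|x]; [exact: measurable_cosM|exact: cos_max].
have iS : mu.-integrable setT (EFin \o (fun x => sin (2 * pi * z * x))).
  by apply: integrable_norm_le1 => [|x]; [exact: measurable_sinM|exact: sin_max].
have E1 (x : R) : 2 * pi * (3 * z) * (x / 3) = 2 * pi * z * x by field.
have E2 (x : R) : 2 * pi * (3 * z) * (x / 3 + 2 / 3) = 2 * pi * z * x + 4 * pi * z by field.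
have comb (a b : R) : \int[mu]_x (a * cos (2 * pi * z * x) + b * sin (2 * pi * z * x))
    = a * C + b * S.
  by rewrite RintegralD// ?RintegralZl//;
      apply: (@integrableZl _ _ _ mu setT measurableT _ (EFin \o _)).
have HC : \int[mu]_x cos (2 * pi * (3 * z) * x) =
    p * C + (1 - p) * (cos (4 * pi * z) * C + - sin (4 * pi * z) * S).
  rewrite (cantor_Rintegral hp0 hp1 hmu (fun x => cos (2 * pi * (3 * z) * x))); last 2 first.
  - exact: measurable_cosM.
  - by move=> x; exact: cos_max.
  congr (_ * _ + _ * _); first by apply: eq_Rintegral => x _; rewrite E1.
  rewrite -comb; apply: eq_Rintegral => x _; rewrite E2 cosD; ring.
have HS : \int[mu]_x sin (2 * pi * (3 * z) * x) =
    p * S + (1 - p) * (sin (4 * pi * z) * C + cos (4 * pi * z) * S).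
  rewrite (cantor_Rintegral hp0 hp1 hmu (fun x => sin (2 * pi * (3 * z) * x))); last 2 first.
  - exact: measurable_sinM.
  - by move=> x; exact: sin_max.
  congr (_ * _ + _ * _); first by apply: eq_Rintegral => x _; rewrite E1.
  rewrite -comb; apply: eq_Rintegral => x _; rewrite E2 sinD; ring.
rewrite !fourier_norm_sqr HC HS -/C -/S.
have := cos2Dsin2 (4 * pi * z).
move: (cos _) (sin _) => c s cs.
(* The sine is gathered into [c ^+ 2 + s ^+ 2], so that the Pythagorean identity [cs] removes it. *)
rewrite [LHS](_ : _ =
    (p ^+ 2 + 2 * p * (1 - p) * c + (1 - p) ^+ 2 * (c ^+ 2 + s ^+ 2)) *
    (C ^+ 2 + S ^+ 2)).
  by rewrite cs; ring.
ring.
Qed.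

End cantor.
End fourier.

(** * Powers on triadic shells *)

Section powers.
Context {R : realType}.
Implicit Types (x t z s : R).

Lemma expr_unbounded x (M : R) : 1 < x -> exists n, M < x ^+ n.
Proof.
move=> x1; have x0 : 0 < x by exact: lt_trans x1.
have : `|x^-1| < 1 by rewrite ger0_norm ?invr_ge0 ?ltW// invf_lt1.
move=> /cvg_expr /cvgrPdist_lt /(_ (`|M| + 1)^-1).
rewrite invr_gt0 ltr_pwDr// => /(_ isT) [n _ /(_ n (leqnn n))] /=.
rewrite sub0r normrN ger0_norm ?exprn_ge0 ?invr_ge0 ?ltW// exprVn.
rewrite ltf_pV2 ?posrE ?exprn_gt0 ?ltr_pwDr// => Mx.
by exists n; apply: le_lt_trans Mx; rewrite (le_trans (ler_norm _))// lerDl.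
Qed.

(** The ratio [z / t] lies between 1 and 3, so its power [al] is at least its power $-|al|$,
    whatever the sign of [al]. *)
Lemma powR_ge_shell (al t z : R) : 0 < t -> t <= z <= 3 * t ->
  (3 `^ `|al|)^-1 * t `^ al <= z `^ al.
Proof.
move=> t0 /andP[tz zt].
have w1 : 1 <= z / t by rewrite ler_pdivlMr// mul1r.
have w3 : z / t <= 3 by rewrite ler_pdivrMr.
rewrite (_ : z = (z / t) * t); last by field; rewrite gt_eqF.
have w0 : 0 < z / t by exact: lt_le_trans w1.
rewrite [leRHS]powRM ?(ltW w0) ?(ltW t0)// ler_wpM2r ?powR_ge0//.
apply: (@le_trans _ _ ((z / t) `^ (- `|al|))).
  rewrite powRN lef_pV2 ?posrE ?powR_gt0//.
  by rewrite ge0_ler_powR// nnegrE ltW.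
by rewrite ler_powR// lerNl ler_normr lexx orbT.
Qed.

Lemma powR_le_shell (al t z : R) : 0 < t -> t <= z <= 3 * t ->
  z `^ al <= 3 `^ `|al| * t `^ al.
Proof.
move=> t0 ht.
have := powR_ge_shell (- al) t z t0 ht.
rewrite normrN !powRN -invfM lef_pV2 ?posrE ?mulr_gt0 ?powR_gt0//.
by case/andP: ht => tz _; exact: lt_le_trans tz.
Qed.

Lemma powR_shell_volume t (al : R) n : 0 < t ->
  (t ^+ n) `^ (al - 1) * t ^+ n = (t `^ al) ^+ n.
Proof.
move=> t0; have tn0 : 0 < t ^+ n by rewrite exprn_gt0.
rewrite -[X in _ * X]powRr1 ?(ltW tn0)// -powRD; last first.
  by apply/implyP => _; rewrite gt_eqF.
rewrite subrK -[in LHS]powR_mulrn ?(ltW t0)// -[RHS]powR_mulrn ?powR_ge0//.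
by rewrite powRAC.
Qed.

End powers.

(** * Summing an integral over triadic shells *)

Section geometric_shells.
Context {R : realType}.
Local Notation leb := (@lebesgue_measure R).
Local Open Scope ereal_scope.

Lemma ge0_even_integral_le (f : R -> \bar R) :
  measurable_fun [set: R] f -> (forall x, 0 <= f x) -> (forall x, f (- x)%R = f x) ->
  \int[leb]_x f x <= 2%:E * \int[leb]_(x in `]0%R, +oo[) f x.
Proof.
move=> mf f0 fN.
have mS (A : set R) : measurable_fun A f by exact: measurable_funTS.
rewrite -(setUv `]-oo, 0%R]%classic) ge0_integral_setU//; last 3 first.
- exact: measurableC.
- by rewrite setUv.
- exact/disj_setPCl.
rewrite setCitvl.
have <- : \int[leb]_(x in `[0%R, +oo[) f x = \int[leb]_(x in `]-oo, 0%R]) f x.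
  rewrite ge0_integration_by_substitution0//.
  by apply: eq_integral => x _; rewrite fN.
by rewrite -integral_itv_obnd_cbnd// mule_natl mule2n.
Qed.

(** The intervals [D n] exhaust the half-line, and passing to the next one adds an inner and an
    outer shell at cost at most [2 * M * rho ^+ n]. Monotone convergence carries the geometric bound
    to the limit. *)
Lemma integral_shells_le (f : R -> \bar R) (M rho : R) :
  measurable_fun (`]0%R, +oo[%classic : set R) f -> (forall x, 0 <= f x) ->
  (0 <= M)%R -> (0 <= rho < 1)%R ->
  (forall n, \int[leb]_(x in `[(3 ^+ n)%R, (3 ^+ n.+1)%R]) f x <= (M * rho ^+ n)%:E) ->
  (forall n, \int[leb]_(x in `[(3 ^- n.+1)%R, (3 ^- n)%R]) f x <= (M * rho ^+ n)%:E) ->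
  \int[leb]_(x in `]0%R, +oo[) f x <= (2 * M / (1 - rho))%:E.
Proof.
move=> mf f0 M0 /andP[rho0 rho1] outer inner.
pose D n : set R := `[(3 ^- n)%R, (3 ^+ n)%R]%classic.
have p3 n : (0 < 3 ^+ n :> R)%R by rewrite exprn_gt0.
have iv0 n : (0 < 3 ^- n :> R)%R by rewrite invr_gt0.
have mSub (A : set R) : measurable A -> A `<=` `]0%R, +oo[%classic -> measurable_fun A f.
  by move=> mA AD; exact: measurable_funS mf.
have Dpos n : D n `<=` `]0%R, +oo[.
  by move=> x /=; rewrite !in_itv/= andbT => /andP[/(lt_le_trans (iv0 _)) ? _].
have ndD : nondecreasing_seq D.
  move=> i j ij; apply/subsetPset => x; rewrite /D/= !in_itv/= => /andP[mx xm].
  rewrite (le_trans _ mx) ?(le_trans xm)//.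
    by rewrite ler_weXn2l// ler1n.
  by rewrite lef_pV2 ?posrE// ler_weXn2l// ler1n.
have UD : \bigcup_n D n = `]0%R, +oo[%classic.
  apply/seteqP; split=> [x [n _]|x /=]; first exact: Dpos.
  rewrite in_itv/= andbT => x0.
  have [m xm] := expr_unbounded 3 x (ltr1n _ 3).
  have [n xn] := expr_unbounded 3 x^-1 (ltr1n _ 3).
  exists (maxn m n) => //; rewrite /D/= in_itv/=; apply/andP; split.
    rewrite -[leRHS]invrK lef_pV2 ?posrE ?invr_gt0//.
    by rewrite (le_trans (ltW xn))// ler_weXn2l ?ler1n// leq_maxr.
  by rewrite (le_trans (ltW xm))// ler_weXn2l ?ler1n// leq_maxl.
have step n : \int[leb]_(x in D n.+1) f x <=
    \int[leb]_(x in D n) f x + (2 * M * rho ^+ n)%:E.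
  (* Half-open end pieces make the three sets disjoint, so that the integral splits additively. *)
  have sub : D n.+1 `<=` `[(3 ^- n.+1)%R, (3 ^- n)%R[%classic `|`
      (D n `|` `](3 ^+ n)%R, (3 ^+ n.+1)%R]%classic).
    move=> x; rewrite /D/= !in_itv/= => /andP[x1 x2].
    by case: ltP => h1; [left; rewrite x1|right; case: leP => h2; [left|right]].
  set A := `[(3 ^- n.+1)%R, (3 ^- n)%R[%classic in sub.
  set B := `](3 ^+ n)%R, (3 ^+ n.+1)%R]%classic in sub.
  have Apos : A `<=` `]0%R, +oo[.
    by move=> x /=; rewrite !in_itv/= andbT => /andP[/(lt_le_trans (iv0 _)) ? _].
  have Bpos : B `<=` `]0%R, +oo[.
    by move=> x /=; rewrite !in_itv/= andbT => /andP[/(lt_trans (p3 _)) ? _].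
  have DBpos : D n `|` B `<=` `]0%R, +oo[ by rewrite subUset.
  have Upos : A `|` (D n `|` B) `<=` `]0%R, +oo[ by rewrite subUset.
  have [mA mB mDn] : [/\ measurable A, measurable B & measurable (D n)].
    by split; exact: measurable_itv.
  have mDB : measurable (D n `|` B) by apply: measurableU; exact: measurable_itv.
  have mU : measurable (A `|` (D n `|` B)) by apply: measurableU => //; exact: measurable_itv.
  have mD : measurable (D n.+1) by exact: measurable_itv.
  apply: le_trans (ge0_subset_integral leb mD mU (mSub _ mU Upos) _ sub) _ => //.
  rewrite ge0_integral_setU//; last 2 first.
  - exact: mSub.
  - apply/disj_setPLR => x; rewrite /A /B /D/= !in_itv/=.
    move=> /andP[_ xl] [/andP[+ _]|/andP[+ _]].
      by rewrite leNgt xl.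
    move=> /lt_trans /(_ xl); rewrite ltNge => /negP; apply.
    by rewrite (@le_trans _ _ 1%R)// ?invf_le1// exprn_ege1// ler1n.
  rewrite ge0_integral_setU//; last 2 first.
  - exact: mSub.
  - apply/disj_setPLR => x; rewrite /B /D/= !in_itv/= => /andP[_ xl] /andP[+ _].
    by rewrite ltNge xl.
  rewrite addeCA leeD2l//.
  rewrite (_ : (2 * M * rho ^+ n = M * rho ^+ n + M * rho ^+ n)%R); last by ring.
  rewrite EFinD leeD//.
    apply: le_trans _ (inner n); apply: ge0_subset_integral => //.
      by apply: mSub => // x /=; rewrite !in_itv/= andbT => /andP[/(lt_le_trans (iv0 _)) ? _].
    exact: subset_itv_co_cc.
  apply: le_trans _ (outer n); apply: ge0_subset_integral => //.
    by apply: mSub => // x /=; rewrite !in_itv/= andbT => /andP[/(lt_le_trans (p3 _)) ? _].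
  exact: subset_itv_oc_cc.
(* The partial geometric sum in closed form; it starts at 0 because [D 0] is the single point 1. *)
have bound n : \int[leb]_(x in D n) f x <= (2 * M * (1 - rho ^+ n) / (1 - rho))%:E.
  elim: n => [|n IH].
    by rewrite /D !expr0 invr1 set_itv1 integral_set1 subrr mulr0 mul0r.
  apply: le_trans (step n) _.
  apply: le_trans (leeD2r _ IH) _; rewrite -EFinD lee_fin le_eqVlt; apply/orP; left.
  by apply/eqP; rewrite exprS; field; rewrite subr_eq0 gt_eqF.
rewrite -UD.
have mD n : measurable (D n) by exact: measurable_itv.
have cv : \int[leb]_(x in D n) f x @[n --> \oo] -->
    \int[leb]_(x in \bigcup_n D n) f x.
  by apply: ge0_nondecreasing_set_cvg_integral => // n; exact: mSub.
rewrite -(cvg_lim _ cv)//; apply: lime_le; first by apply/cvg_ex; eexists; exact: cv.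
apply: nearW => n; apply: le_trans (bound n) _; rewrite lee_fin.
rewrite ler_pM2r ?invr_gt0 ?subr_gt0// ler_piMr ?mulr_ge0//.
by rewrite gerBl exprn_ge0.
Qed.

End geometric_shells.

(** * Lower and upper bounds for the energy integrals *)

Section cantor_energy.
Context {R : realType} {mu : probability (measurableTypeR R) R} {p : R}
  (hp0 : 0 < p) (hp1 : p < 1) (hmu : is_cantor_measure p mu).
Local Notation leb := (@lebesgue_measure R).
Local Notation N := (fourier_norm mu).

(** The squared modulus of $q+(1-q)e^{-4\pi iz}$. Here [q] is the weight of the first map, not its
    complement. *)
Definition cantor_factor (q z : R) : R :=
  q ^+ 2 + (1 - q) ^+ 2 + 2 * q * (1 - q) * cos (4 * pi * z).

Let q0 : 0 < 2 * p * (1 - p).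
Proof. by rewrite !mulr_gt0// subr_gt0. Qed.

Lemma cantor_factor_ge0 z : 0 <= cantor_factor p z.
Proof.
apply: (@le_trans _ _ ((p - (1 - p)) ^+ 2)); first exact: sqr_ge0.
have : 2 * p * (1 - p) * -1 <= 2 * p * (1 - p) * cos (4 * pi * z).
  by rewrite ler_pM2l// cos_geN1.
rewrite /cantor_factor; lra.
Qed.

(** On both ranges [4 * pi * u] is within [2 * pi / 3] of a multiple of [2 * pi]. They stay away
    from 1/4, where the factor is smallest and vanishes if [p] is 1/2. *)
Lemma cantor_factor_gt (u : R) : 0 <= u <= 6^-1 \/ 3^-1 <= u <= 2^-1 ->
  p ^+ 2 + (1 - p) ^+ 2 + 2 * p * (1 - p) * cos (2 * pi / 3) <= cantor_factor p u.
Proof.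
have pi0 := pi_gt0 R.
have aux (v : R) : 0 <= v <= 6^-1 -> cos (2 * pi / 3) <= cos (4 * pi * v).
  move=> /andP[v0 v6]; have vpi : pi * v <= pi * 6^-1 by rewrite ler_pM2l.
  have vpi0 : 0 <= pi * v by rewrite mulr_ge0// ltW.
  rewrite leNgt ltr_cos ?in_itv/=; last 2 first.
  - by apply/andP; split; lra.
  - by apply/andP; split; lra.
  by rewrite -leNgt; lra.
move=> hu; rewrite lerD2l ler_pM2l//; case: hu => [/aux//|/andP[u3 u2]].
(* The reflection of [u] to [2^-1 - u] carries the second range into the first. *)
rewrite (_ : 4 * pi * u = - (4 * pi * (2^-1 - u)) + pi *+ 2); last first.
  by rewrite -[pi *+ 2]mulr_natr; field.
rewrite cosD2pi cosN; apply: aux; apply/andP; split; lra.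
Qed.

Lemma cantor_factor_min_gt0 :
  0 < p ^+ 2 + (1 - p) ^+ 2 + 2 * p * (1 - p) * cos (2 * pi / 3).
Proof.
have pi0 := pi_gt0 R.
have cgt : -1 < cos (2 * pi / 3) :> R.
  rewrite -cospi ltr_cos ?in_itv/=; first by lra.
  - by apply/andP; split; lra.
  - by apply/andP; split; lra.
apply: (@le_lt_trans _ _ ((p - (1 - p)) ^+ 2)); first exact: sqr_ge0.
have : 2 * p * (1 - p) * -1 < 2 * p * (1 - p) * cos (2 * pi / 3) by rewrite ltr_pM2l.
lra.
Qed.

(** One division by 3 brings [y] into [1/3, 1/2], and further ones into [0, 1/6]; each costs only
    the positive factor [k]. After finitely many, the same number for all [y], the argument is so
    near 0 that continuity and [N 0 = 1] give a lower bound. *)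
Lemma fourier_norm_lower :
  exists2 c : R, 0 < c & forall y, 1 <= y <= 3 / 2 -> c <= N y ^+ 2.
Proof.
set k := p ^+ 2 + (1 - p) ^+ 2 + 2 * p * (1 - p) * cos (2 * pi / 3).
have k0 : 0 < k by exact: cantor_factor_min_gt0.
have stepN (y : R) : 0 <= y / 3 <= 6^-1 \/ 3^-1 <= y / 3 <= 2^-1 ->
    k * N (y / 3) ^+ 2 <= N y ^+ 2.
  move=> /cantor_factor_gt hy.
  rewrite [in leRHS](_ : y = 3 * (y / 3)); last by field.
  by rewrite (fourier_norm_refine hp0 hp1 hmu) ler_wpM2r// sqr_ge0.
have near0 m (y : R) : 0 <= y <= 2^-1 -> k ^+ m * N (y / 3 ^+ m) ^+ 2 <= N y ^+ 2.
  elim: m y => [|m IH] y /andP[y0 y2]; first by rewrite !expr0 mul1r divr1.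
  apply: le_trans (stepN y _); last by left; apply/andP; split; lra.
  rewrite exprS -mulrA ler_pM2l// [3 ^+ _]exprS invfM [y * _]mulrA; apply: IH.
  by apply/andP; split; lra.
have : \forall y \near nbhs (0 : R), 2^-1 < N y.
  have half0 : 0 < 2^-1 :> R by rewrite invr_gt0.
  have /cvgrPdist_lt /(_ _ half0) := @continuous_fourier_norm R mu 0.
  rewrite fourier_norm0; apply: filterS => y.
  by rewrite ltr_norml => /andP[]; lra.
move=> /nbhs_ballP[d /= d0 hd].
have [m dm] := expr_unbounded 3 d^-1 (ltr1n _ 3).
(* One [k] for the first division, [k ^+ m] for the others, and 1/4 for the square of the bound 1/2
   near 0. *)
exists (k * (k ^+ m * (1 / 4))) => [|y /andP[y1 y2]].
  by rewrite !mulr_gt0// exprn_gt0.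
apply: le_trans (stepN y _); last by right; apply/andP; split; lra.
rewrite ler_pM2l//; apply: le_trans (near0 m _ _); last by apply/andP; split; lra.
rewrite ler_pM2l ?exprn_gt0//.
have : 2^-1 < N (y / 3 / 3 ^+ m).
  apply: hd; rewrite /ball/= sub0r normrN ger0_norm; last first.
    by rewrite !divr_ge0 ?exprn_ge0//; lra.
  have m0 : 0 < 3 ^+ m :> R by rewrite exprn_gt0.
  rewrite ltr_pdivrMr//; apply: (@lt_trans _ _ 1); first by lra.
  by rewrite mulrC -ltr_pdivrMr// div1r.
move: (N _) => v hv; nra.
Qed.

Context {r : nat} {lam a b : R}.
Hypothesis factorE : forall z, cantor_factor p z ^+ r =
  lam + a * cos (4 * pi * z) + b * cos (4 * pi * 2 * z).

(** [P] is the product of the [r]-th powers of the factor at [n] successive triadic scales. By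
    absence of resonance its mean is exactly [lam ^+ n]. *)
Lemma fourier_norm_product n : exists P : R -> R,
  [/\ cos_poly (lam ^+ n) P, forall x, 0 <= P x &
      forall x, N (3 ^+ n * x) ^+ (2 * r) = P x * N x ^+ (2 * r)].
Proof.
elim: n => [|n [P [Pc P0 PE]]].
  exists (fun=> 1); split => // [|x]; first exact: cos_poly_cst.
  by rewrite mul1r expr0 mul1r.
(* The new factor enters at the lowest frequency and the old product is dilated, the shape that
   [cos_poly_triple] handles. *)
exists (fun x => cantor_factor p x ^+ r * P (3 * x)); split => [|x|x].
- have := cos_poly_triple _ _ lam a b Pc; rewrite exprS.
  by under [X in cos_poly _ X]eq_fun do rewrite -factorE.
- by rewrite mulr_ge0// exprn_ge0// cantor_factor_ge0.
- rewrite exprSr -mulrA PE exprM (fourier_norm_refine hp0 hp1 hmu) exprMn -exprM.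
  by rewrite -/(cantor_factor p x) mulrCA mulrA.
Qed.

Hypothesis lam0 : 0 < lam.

Let f (al z : R) : R := N z ^+ (2 * r) * `|z| `^ (al - 1).

Let f0 al z : 0 <= f al z.
Proof. by rewrite mulr_ge0 ?powR_ge0// exprn_ge0// fourier_norm_ge0. Qed.

Let mf al : measurable_fun [set: R] (f al).
Proof.
apply: measurable_funM.
  apply: measurable_funX; apply: continuous_measurable_fun.
  exact: continuous_fourier_norm.
apply: (@measurableT_comp _ _ _ _ _ _ (@powR R ^~ (al - 1)) _ (@Num.norm _ R)).
  exact: measurable_powR.
exact: normr_measurable.
Qed.

Let fE al z : 0 < z -> f al z = N z ^+ (2 * r) * z `^ (al - 1).
Proof. by move=> z0; rewrite /f gtr0_norm. Qed.

(** With $t=3^n$, the piece from [t] to [3 * t / 2] suffices: there [N (z / t)] is bounded below,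
    and its length is one full period of the dilated [P]. These single contributions are already
    unbounded in [n]. *)
Lemma energy_lower al : 1 < 3 `^ al * lam ->
  (\int[leb]_z (N z ^+ (2 * r) * `|z| `^ (al - 1))%:E = +oo)%E.
Proof.
move=> rho1.
have [c c0 Nc] := fourier_norm_lower.
(* Distortion of the weight on the shell, lower bound for the transform, and relative length 1/2 of
   the piece. *)
pose K : R := (3 `^ `|al - 1|)^-1 * c ^+ r / 2.
have K0 : 0 < K by rewrite !mulr_gt0// ?invr_gt0 ?powR_gt0 ?exprn_gt0.
have lower n : ((K * (3 `^ al * lam) ^+ n)%:E <= \int[leb]_z (f al z)%:E)%E.
  have [P [Pc P0 PE]] := fourier_norm_product n.
  pose t : R := 3 ^+ n.
  have t0 : 0 < t by rewrite exprn_gt0.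
  pose k : R := (3 `^ `|al - 1|)^-1 * t `^ (al - 1) * c ^+ r.
  have k0 : 0 <= k by rewrite !mulr_ge0 ?invr_ge0 ?powR_ge0// exprn_ge0// ltW.
  have mP : measurable_fun [set: R] (fun z => P (z / t)).
    by apply: continuous_measurable_fun; exact: continuous_cos_poly_scale Pc.
  apply: (@le_trans _ _
      (\int[leb]_(z in `[(t * 1)%R, (t * (1 + 1%:R / 2))%R]) (k * P (z / t))%:E)%E).
    under eq_integral do rewrite EFinM.
    rewrite ge0_integralZl_EFin//; last 2 first.
    - by move=> z _; rewrite lee_fin.
    - by apply/measurable_EFinP; exact: measurable_funTS.
    rewrite (cos_poly_integral _ _ _ _ _ Pc)// -EFinM lee_fin le_eqVlt; apply/orP; left.
    apply/eqP; rewrite exprMn -powR_shell_volume// -/t /k /K; ring.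
  apply: (@le_trans _ _
      (\int[leb]_(z in `[(t * 1)%R, (t * (1 + 1%:R / 2))%R]) (f al z)%:E)%E).
    apply: ge0_le_integral => //.
    - by move=> z _; rewrite lee_fin mulr_ge0.
    - by apply/measurable_EFinP; apply: measurable_funTS;
        apply: (@measurable_funM _ _ _ _ (cst k)).
    - by apply/measurable_EFinP; apply: measurable_funTS; exact: (mf al).
    - move=> z; rewrite /= in_itv/= mulr1 => /andP[tz zt]; rewrite lee_fin.
      have z0 : 0 < z by exact: lt_le_trans tz.
      have zE : z = t * (z / t) by field; rewrite gt_eqF.
      rewrite fE// [in N z]zE PE.
      have : c ^+ r <= N (z / t) ^+ (2 * r).
        rewrite exprM lerXn2r ?nnegrE ?sqr_ge0 ?(ltW c0)//; apply: Nc.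
        rewrite ler_pdivlMr// mul1r tz /= ler_pdivrMr//.
        by apply: le_trans zt _; rewrite le_eqVlt; apply/orP; left; apply/eqP; field.
      have : (3 `^ `|al - 1|)^-1 * t `^ (al - 1) <= z `^ (al - 1).
        apply: powR_ge_shell => //; rewrite tz/=; lra.
      move=> h1 h2; rewrite [leLHS]mulrC -[leRHS]mulrA; apply: ler_wpM2l => //.
      rewrite /k [leRHS]mulrC; apply: ler_pM => //; last by rewrite exprn_ge0// ltW.
      by rewrite mulr_ge0 ?invr_ge0 ?powR_ge0.
  apply: ge0_subset_integral => //; first by apply/measurable_EFinP; exact: (mf al).
  by move=> z _; rewrite lee_fin.
apply/eqyP => e e0.
have [n en] := expr_unbounded _ (e / K) rho1.
apply: le_trans (lower n); rewrite lee_fin.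
by move: en; rewrite ltr_pdivrMr// mulrC => /ltW.
Qed.

(** Outer shells decay with ratio [3]^ al *
    lam[by the exact mean of]P[; inner shells decay with ratio](3 [^ al)^-1] because the weight is
    integrable at 0. *)
Lemma energy_upper al : 0 < al -> 3 `^ al * lam < 1 ->
  (\int[leb]_z (N z ^+ (2 * r) * `|z| `^ (al - 1))%:E < +oo)%E.
Proof.
move=> al0 rho1.
have h3 : 0 < 3 `^ al :> R by rewrite powR_gt0.
have inv1 : (3 `^ al)^-1 < 1 :> R.
  rewrite invf_lt1// -[ltLHS](powRr0 3) /powR pnatr_eq0/= ltr_expR mul0r.
  by rewrite mulr_gt0// ln_gt0// ltr1n.
(* One ratio that serves the inner and the outer shells at once. *)
pose rho : R := Num.max ((3 `^ al)^-1) (3 `^ al * lam).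
have rho0 : 0 <= rho by rewrite le_max invr_ge0 ltW.
have rhol1 : rho < 1 by rewrite gt_max inv1.
(* Bound for the transform, distortion of the weight, and relative length 2 of a whole shell. *)
pose M : R := 2 ^+ (2 * r) * 3 `^ `|al - 1| * 2.
have M0 : 0 <= M by rewrite !mulr_ge0// powR_ge0.
have N2 z : N z ^+ (2 * r) <= 2 ^+ (2 * r).
  by rewrite lerXn2r ?nnegrE ?fourier_norm_ge0// fourier_norm_le2.
apply: (le_lt_trans (ge0_even_integral_le _ _ _ _)).
- apply/measurable_EFinP; exact: (mf al).
- by move=> z; rewrite lee_fin; exact: (f0 al).
- by move=> z; rewrite fourier_normN normrN.
apply: (@le_lt_trans _ _ (2%:E * (2 * M / (1 - rho))%:E)%E); last by rewrite -EFinM ltry.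
rewrite lee_pmul2l//.
apply: integral_shells_le => //.
- by apply/measurable_EFinP; apply: measurable_funTS; exact: (mf al).
- by move=> z; rewrite lee_fin; exact: (f0 al).
- by rewrite rho0.
- move=> n; have [P [Pc P0 PE]] := fourier_norm_product n.
  pose t : R := 3 ^+ n.
  have t0 : 0 < t by rewrite exprn_gt0.
  pose k : R := 2 ^+ (2 * r) * (3 `^ `|al - 1| * t `^ (al - 1)).
  have k0 : 0 <= k by rewrite !mulr_ge0 ?powR_ge0.
  have mP : measurable_fun [set: R] (fun z => P (z / t)).
    by apply: continuous_measurable_fun; exact: continuous_cos_poly_scale Pc.
  rewrite (_ : 3 ^+ n = t * 1); last by rewrite mulr1.
  (* A whole shell is four periods of length [t / 2]. *)
  rewrite (_ : 3 ^+ n.+1 = t * (1 + 4%:R / 2)); last by rewrite exprSr -/t; field.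
  apply: (@le_trans _ _
      (\int[leb]_(z in `[(t * 1)%R, (t * (1 + 4%:R / 2))%R]) (k * P (z / t))%:E)%E).
    apply: ge0_le_integral => //.
    - by move=> z _; rewrite lee_fin; exact: (f0 al).
    - by apply/measurable_EFinP; apply: measurable_funTS; exact: (mf al).
    - by apply/measurable_EFinP; apply: measurable_funTS;
        apply: (@measurable_funM _ _ _ _ (cst k)).
    - move=> z; rewrite /= in_itv/= mulr1 => /andP[tz zt]; rewrite lee_fin.
      have z0 : 0 < z by exact: lt_le_trans tz.
      have zE : z = t * (z / t) by field; rewrite gt_eqF.
      rewrite -/(f al z) fE// [in N z]zE PE.
      have h1 : z `^ (al - 1) <= 3 `^ `|al - 1| * t `^ (al - 1).
        by apply: powR_le_shell => //; rewrite tz/=; lra.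
      rewrite /k [leRHS]mulrC -mulrA; apply: ler_wpM2l => //.
      by apply: ler_pM => //; rewrite ?powR_ge0// exprn_ge0// fourier_norm_ge0.
  under eq_integral do rewrite EFinM.
  rewrite ge0_integralZl_EFin//; last 2 first.
  - by move=> z _; rewrite lee_fin.
  - by apply/measurable_EFinP; exact: measurable_funTS.
  rewrite (cos_poly_integral _ _ _ _ _ Pc)// -EFinM lee_fin.
  rewrite (_ : k * _ = M * (3 `^ al * lam) ^+ n); last first.
    by rewrite exprMn -powR_shell_volume// -/t /k /M; field.
  rewrite ler_wpM2l// lerXn2r ?nnegrE//; last by rewrite le_max lexx orbT.
  by rewrite mulr_ge0 ?powR_ge0// ltW.
(* Near 0 the uniform bound on the transform is enough, without cancellation. *)
- move=> n; pose t : R := 3 ^- n.+1.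
  have t0 : 0 < t by rewrite invr_gt0 exprn_gt0.
  have -> : 3 ^- n = 3 * t :> R.
    by rewrite /t exprS invfM mulrA divff ?mul1r ?pnatr_eq0.
  rewrite -/t.
  apply: (@le_trans _ _ (\int[leb]_(z in `[t, (3 * t)%R])
      (cst (2 ^+ (2 * r) * (3 `^ `|al - 1| * t `^ (al - 1)))%:E) z)%E).
    apply: ge0_le_integral => //.
    - by move=> z _; rewrite lee_fin; exact: (f0 al).
    - by apply/measurable_EFinP; apply: measurable_funTS; exact: (mf al).
    - move=> z; rewrite /= in_itv/= => /andP[tz zt]; rewrite lee_fin.
      have z0 : 0 < z by exact: lt_le_trans tz.
      rewrite -/(f al z) fE//; apply: ler_pM; rewrite ?powR_ge0 ?exprn_ge0 ?fourier_norm_ge0//.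
      by apply: powR_le_shell => //; rewrite tz.
  rewrite integral_cst//= lebesgue_measure_itv/= lte_fin ifT; last by lra.
  rewrite -EFinB -EFinM lee_fin.
  have -> : 2 ^+ (2 * r) * (3 `^ `|al - 1| * t `^ (al - 1)) * (3 * t - t) =
      M * (t `^ (al - 1) * t).
    by rewrite /M; ring.
  rewrite ler_wpM2l//.
  have -> : t `^ (al - 1) * t = (3 `^ al)^-1 ^+ n.+1.
    rewrite mulrC mulr_powRB1 ?(ltW t0)// /t -exprVn -powR_mulrn ?invr_ge0// powRAC.
    rewrite powR_mulrn ?powR_ge0//; congr (_ ^+ _).
    by rewrite -powR_inv1// powRAC powR_inv1// powR_ge0.
  (* The shell indexed by [n] starts at $3^{-(n+1)}$; the surplus factor is below 1 and is
     dropped. *)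
  rewrite exprS; apply: (@le_trans _ _ (1 * (3 `^ al)^-1 ^+ n)).
    by rewrite ler_wpM2r// ?exprn_ge0 ?invr_ge0 ?powR_ge0// ltW.
  by rewrite mul1r lerXn2r ?nnegrE ?invr_ge0 ?powR_ge0// le_max lexx.
Qed.

End cantor_energy.

(** * From energy thresholds to the spectrum *)

Section spectrum.
Context {R : realType} {mu : probability (measurableTypeR R) R} {p : R}
  (hp0 : 0 < p) (hp1 : p < 1) (hmu : is_cantor_measure p mu).
Local Notation N := (fourier_norm mu).

(** A supremum ignores what happens at [s0] itself, and the adjoined 0 covers the case where [s0] is
    0. *)
Lemma fourier_spectrum_threshold (theta s0 : R) : 0 <= s0 ->
  (forall s, 0 < s -> s < s0 -> (fourier_energy mu s theta < +oo)%E) ->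
  (forall s, s0 < s -> fourier_energy mu s theta = +oo%E) ->
  fourier_spectrum mu theta = s0%:E.
Proof.
move=> s00 fin infin; apply/eqP; rewrite eq_le; apply/andP; split.
  apply: ge_ereal_sup => _ [->|[s [_ /= es] <-]]; rewrite lee_fin//.
  by rewrite leNgt; apply/negP => /infin es'; rewrite es' ltxx in es.
rewrite leNgt; apply/negP => lt_s0.
have ge0 : (0 <= fourier_spectrum mu theta)%E by apply: ereal_sup_ubound; left.
case E : (fourier_spectrum mu theta) lt_s0 ge0 => [x| |] //.
rewrite lte_fin lee_fin => xs0 x0.
have : (((x + s0) / 2)%:E <= fourier_spectrum mu theta)%E.
  (* A supremum [x] below [s0] is contradicted by the midpoint, whose energy is finite. *)
  apply: ereal_sup_ubound; right; exists ((x + s0) / 2) => //; split; first by lra.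
  by apply: fin; lra.
by rewrite E lee_fin; lra.
Qed.

Lemma fourier_energyE (r : nat) (s : R) : (0 < r)%N ->
  fourier_energy mu s r%:R^-1 =
  poweR (\int[lebesgue_measure]_z (N z ^+ (2 * r) * `|z| `^ (r%:R * s - 1))%:E)%E
    r%:R^-1.
Proof.
move=> r0; have r0' : r%:R != 0 :> R by rewrite pnatr_eq0 -lt0n.
rewrite /fourier_energy ifF; last by apply/negbTE; rewrite invr_eq0.
apply: (congr1 (fun v => poweR v _)); apply: eq_integral => z _.
apply: (congr1 EFin); rewrite !invrK -natrM powR_mulrn; last exact: fourier_norm_ge0.
by rewrite [s * _]mulrC.
Qed.

(** The ratio $3^{rs}\,lam$ is the exponential of a positive multiple of [s] minus the claimed
    value, so it crosses 1 exactly there. *)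
Lemma fourier_spectrum_inv (r : nat) (lam a b : R) : (0 < r)%N ->
  0 < lam < 1 ->
  (forall z, cantor_factor p z ^+ r =
    lam + a * cos (4 * pi * z) + b * cos (4 * pi * 2 * z)) ->
  fourier_spectrum mu r%:R^-1 = (ln lam / (- r%:R * ln 3))%:E.
Proof.
move=> r0 /andP[lam0 lam1] factorE.
have ln3 : 0 < ln 3 :> R by rewrite ln_gt0// ltr1n.
have lnl : ln lam < 0 by rewrite ln_lt0// lam0.
have rr : 0 < r%:R :> R by rewrite ltr0n.
have rho s : 3 `^ (r%:R * s) * lam = expR (r%:R * ln 3 * (s - ln lam / (- r%:R * ln 3))).
  rewrite /powR pnatr_eq0/= -[in LHS](lnK (x := lam)) ?posrE// -expRD; congr expR.
  by field; rewrite !gt_eqF.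
have s00 : 0 < ln lam / (- r%:R * ln 3).
  rewrite mulNr invrN mulrN -mulNr divr_gt0 ?oppr_gt0// mulr_gt0//.
apply: fourier_spectrum_threshold => [|s s0 ss|s ss]; first exact: ltW.
  rewrite fourier_energyE//; apply: poweR_lty.
  apply: (energy_upper hp0 hp1 hmu factorE) => //; first exact: mulr_gt0.
  by rewrite rho expR_lt1 pmulr_rlt0 ?mulr_gt0// subr_lt0.
rewrite fourier_energyE// (energy_lower hp0 hp1 hmu factorE)//.
  by rewrite poweRyr// invr_eq0 gt_eqF.
by rewrite rho expR_gt1 mulr_gt0 ?mulr_gt0// subr_gt0.
Qed.

(** At integers the cosine is 1 and the refinement factor is the square of $p+(1-p)=1$. *)
Lemma fourier_norm_expr3 n : N (3 ^+ n) = N 1.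
Proof.
elim: n => [|n IH]; first by rewrite expr0.
apply/eqP; rewrite -(@eqrXn2 _ 2)// ?fourier_norm_ge0//; apply/eqP.
have cos3 : cos (4 * pi * 3 ^+ n) = 1 :> R.
  have -> : 4 * pi * 3 ^+ n = 0 + pi *+ 2 *+ (2 * 3 ^ n) :> R.
    by rewrite add0r -mulrnA -[RHS]mulr_natr !natrM natrX; ring.
  by rewrite (periodicn (@cosD2pi R)) cos0.
rewrite [3 ^+ n.+1]exprS (fourier_norm_refine hp0 hp1 hmu (3 ^+ n)) IH cos3; ring.
Qed.

(** Along powers of 3 the transform keeps the nonzero modulus [N 1], while $|z|^s$ is unbounded for
    positive [s]. *)
Lemma fourier_spectrum0 : fourier_spectrum mu 0 = 0%:E.
Proof.
apply: fourier_spectrum_threshold => // [s s0 /lt_geF|s s0].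
  by rewrite ltW.
rewrite /fourier_energy eqxx; apply/eqyP => e e0.
have [c c0 Nc] := fourier_norm_lower hp0 hp1 hmu.
have h3 : 1 < 3 `^ s :> R.
  by rewrite /powR pnatr_eq0/= expR_gt1 mulr_gt0// ln_gt0// ltr1n.
have [n en] := expr_unbounded _ (e / c) h3.
apply: le_ereal_sup_tmp; exists ((N (3 ^+ n) ^+ 2 * `|3 ^+ n| `^ s)%:E).
  by exists (3 ^+ n).
rewrite lee_fin ger0_norm ?exprn_ge0// -[X in X `^ s]powR_mulrn// powRAC.
rewrite powR_mulrn ?powR_ge0//.
rewrite fourier_norm_expr3.
rewrite ltr_pdivrMr// in en; apply: le_trans (ltW en) _.
rewrite mulrC ler_wpM2r ?exprn_ge0 ?powR_ge0//; apply: Nc; lra.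
Qed.

End spectrum.

(** * The explicit values and the failure of linearity *)

Theorem corollary4p4 (R : realType) (p : R) (hp0 : 0 < p) (hp1 : p < 1)
    (mu : probability (measurableTypeR R) R) (hmu : is_cantor_measure p mu) :
  (fourier_dim mu = fourier_spectrum mu 0 /\
   fourier_spectrum mu 0 = 0%:E) /\
  fourier_spectrum mu (1 / 2) =
    (ln (p ^+ 4 + 4 * p ^+ 2 * (1 - p) ^+ 2 + (1 - p) ^+ 4)
       / (- 2 * ln 3))%:E /\
  (sobolev_dim mu = fourier_spectrum mu 1 /\
   fourier_spectrum mu 1 = (ln (p ^+ 2 + (1 - p) ^+ 2) / (- ln 3))%:E /\
   (sobolev_dim mu < 2%:E * fourier_spectrum mu (1 / 2))%E) /\
  ~ (exists a b : R, forall theta : R, 0 <= theta <= 1 ->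
       fourier_spectrum mu theta = (a * theta + b)%:E).
Proof.
have q0 : 0 < 1 - p by rewrite subr_gt0.
have pq : 0 < p * (1 - p) by exact: mulr_gt0.
have pq4 : p * (1 - p) <= 1 / 4 by have := sqr_ge0 (p - 1 / 2); lra.
set l4 := p ^+ 4 + _ + _; set l2 := p ^+ 2 + _.
have l2E : l2 = 1 - 2 * (p * (1 - p)) by rewrite /l2; ring.
have l4E : l4 = 1 - 4 * (p * (1 - p)) + 6 * (p * (1 - p)) ^+ 2 by rewrite /l4; ring.
have l2_0 : 0 < l2 by rewrite l2E; lra.
have l4_0 : 0 < l4 by rewrite l4E; move: (p * _) pq pq4 => t t0 t4; nra.
(* The difference [l2 - l4] equals $2t(1-3t)$ with $t=p(1-p)$ at most 1/4. *)
have l42 : l4 < l2 by rewrite l4E l2E; move: (p * _) pq pq4 => t t0 t4; nra.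
have l2_1 : l2 < 1 by rewrite l2E; lra.
have dim0 := fourier_spectrum0 hp0 hp1 hmu.
have dim1 : fourier_spectrum mu 1 = (ln l2 / (- ln 3))%:E.
  have := fourier_spectrum_inv hp0 hp1 hmu 1 l2 (2 * p * (1 - p)) 0.
  rewrite invr1 mulN1r; apply => //; first by rewrite l2_0.
  by move=> z; rewrite expr1 mul0r addr0.
have dim2 : fourier_spectrum mu (1 / 2) = (ln l4 / (- 2 * ln 3))%:E.
  (* These are the coefficients of $(l2+2p(1-p)\cos)^2$ once the squared cosine is halved by the
     double-angle formula; the half it leaves completes the mean to [l4]. *)
  rewrite div1r (fourier_spectrum_inv hp0 hp1 hmu 2 l4
    (4 * p * (1 - p) * l2) (2 * p ^+ 2 * (1 - p) ^+ 2))//.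
    by rewrite l4_0 (lt_trans l42).
  move=> z; rewrite /cantor_factor.
  rewrite (_ : 4 * pi * 2 * z = (4 * pi * z) *+ 2); last by rewrite -mulr_natr; ring.
  by rewrite cos_mulr2n -[_ *+ 2]mulr_natr /l4 /l2; ring.
have dim12 : (sobolev_dim mu < 2%:E * fourier_spectrum mu (1 / 2))%E.
  rewrite /sobolev_dim dim1 dim2 -EFinM lte_fin.
  have ln3 : 0 < ln 3 :> R by rewrite ln_gt0// ltr1n.
  have -> : 2 * (ln l4 / (- 2 * ln 3)) = ln l4 / (- ln 3).
    by field; rewrite gt_eqF.
  (* The negative denominator reverses the order, which leaves [l4 < l2]. *)
  by rewrite ltr_nM2r ?invr_lt0 ?oppr_lt0// ltr_ln ?posrE.
do 3 (split; first by do ?split).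
move=> [a [b lin]]; move: dim12; rewrite /sobolev_dim.
(* With [b] equal to 0, an affine spectrum would take at 1 exactly twice its value at 1/2, against
   the strict inequality. *)
have b0 : 0 = a * 0 + b.
  by apply: EFin_inj; rewrite -dim0; apply: lin; rewrite lexx ler01.
rewrite (lin 1) ?ler01 ?lexx// (lin (1 / 2)); last by apply/andP; split; lra.
by rewrite -EFinM lte_fin; lra.
Qed.
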